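(* Let $Q_1\subset\mathbb{R}^{n_1}$, $Q_2\subset\mathbb{R}^{n_2}$ be convex compact sets, $Q=Q_1\times Q_2$, and let $f(u,v)$ be convex in $u\in Q_1$ and concave in $v\in Q_2$. Suppose that for the saddle point problem of finding $(u_*,v_* )\in Q$ with $f(u_*,v)\leqslant f(u_*,v_* )\leqslant f(u,v_* )$ for all $u\in Q_1$, $v\in Q_2$, there exists a $(\delta,\Delta,L)$-model $\psi_\delta(x,y)$ (in the sense of the context). Then after the adaptive method described in the context stops (having performed $N$ iterations), the point $$\tilde y=(\tilde u,\tilde v):=\frac{1}{S_N}\sum_{k=0}^{N-1}\frac{y^{k+1}}{L_{k+1}},\qquad S_N:=\sum_{k=0}^{N-1}\frac1{L_{k+1}},$$ satisfies $$\max_{v\in Q_2}f(\tilde u,v)-\min_{u\in Q_1}f(u,\tilde v)\leqslant\varepsilon+\frac{1}{S_N}\sum_{k=0}^{N-1}\frac{\Delta_{k+1}\|y^{k+1}-x^{k+1}\|}{L_{k+1}}+2\tilde\delta+2\delta.$$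
   Context: Points of $Q$ are written $x=(u_x,v_x)$, $y=(u_y,v_y)$; $\|x\|=\sqrt{\|u_x\|_1^2+\|v_x\|_2^2}$, where $\|\cdot\|_1$, $\|\cdot\|_2$ are norms on $\mathbb{R}^{n_1}$, $\mathbb{R}^{n_2}$. Bregman divergence: $V(y,x)=d(y)-d(x)-\langle\nabla d(x),y-x\rangle$ for $x,y\in Q$, where $d$ is 1-strongly convex and differentiable at all points of $Q$. Model: for $\delta,\Delta,L>0$, $\psi_\delta$ is a $(\delta,\Delta,L)$-model for the saddle point problem if, for some functional $\psi:Q\times Q\to\mathbb{R}$ and all $x,y,z\in Q$: (i) $\psi(x,y)\leqslant\psi_\delta(x,y)+\delta$; (ii) $\psi_\delta(x,y)$ is convex in the first variable and $\psi_\delta(x,x)=0$; (iii) $\psi_\delta(x,y)+\psi_\delta(y,x)\leqslant\delta$; (iv) $\psi_\delta(x,y)\leqslant\psi_\delta(x,z)+\psi_\delta(z,y)+LV(x,z)+LV(z,y)+\Delta\|y-z\|+\delta$; and in addition $f(u_y,v_x)-f(u_x,v_y)\leqslant-\psi_\delta(x,y)+\delta$ for all $x,y\in Q$. Inexact minimization: for $\tilde\delta\geqslant 0$, $x=\arg\min^{\tilde\delta}_{y\in Q}\varphi(y)$ means $\langle\nabla\varphi(x),x-y\rangle\leqslant\tilde\delta$ for all $y\in Q$ (for a (sub)gradient $\nabla\varphi(x)$). Method. Fix accuracy $\varepsilon>0$, $x^0=\arg\min_{x\in Q}d(x)$, and constants $0<L_0\leqslant 2L$, $0<\Delta_0\leqslant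 2\Delta$. The $(N+1)$-th iteration ($N=0,1,2,\dots$): 1. $L_{N+1}:=L_N/2$, $\Delta_{N+1}:=\Delta_N/2$. 2. Compute $y^{N+1}:=\arg\min^{\tilde\delta}_{x\in Q}\{\psi_\delta(x,x^N)+L_{N+1}V(x,x^N)\}$ and $x^{N+1}:=\arg\min^{\tilde\delta}_{x\in Q}\{\psi_\delta(x,y^{N+1})+L_{N+1}V(x,x^N)\}$. 3. If $$\psi_\delta(x^{N+1},x^N)\leqslant\psi_\delta(y^{N+1},x^N)+\psi_\delta(x^{N+1},y^{N+1})+L_{N+1}V(y^{N+1},x^N)+L_{N+1}V(x^{N+1},y^{N+1})+\Delta_{N+1}\|y^{N+1}-x^{N+1}\|+\delta$$ does not hold, set $L_{N+1}:=2L_{N+1}$, $\Delta_{N+1}:=2\Delta_{N+1}$ and repeat step 2; otherwise go to the next iteration. The method stops after $N$ iterations when $\sum_{k=0}^{N-1}\frac{1}{L_{k+1}}\geqslant\frac{\max_{x\in Q}V(x,x^0)}{\varepsilon}$. *)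

(* Defs.v *)
From HB Require Import structures.
From mathcomp Require Import all_boot all_order all_algebra.
From mathcomp Require Import all_classical all_reals all_analysis.
Import Order.TTheory GRing.Theory Num.Theory.
Import numFieldNormedType.Exports.

Set Implicit Arguments.
Unset Strict Implicit.
Unset Printing Implicit Defensive.

Local Open Scope classical_set_scope.
Local Open Scope ring_scope.

(* An arbitrary norm, unrelated to the canonical [`|x|] of the type.
   Nonnegativity follows from the three axioms. *)
Record is_norm (R : realType) (V : lmodType R) (N : V -> R) : Prop := {
  is_norm_eq0 : forall x, N x = 0 -> x = 0;
  is_norm_triangle : forall x y, N (x + y) <= N x + N y;
  is_norm_scale : forall (a : R) x, N (a *: x) = `|a| * N x
}.

Definition pair_norm (R : realType) (U V : lmodType R)
    (N1 : U -> R) (N2 : V -> R) (x : U * V) : R :=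
  Num.sqrt (N1 x.1 ^+ 2 + N2 x.2 ^+ 2).

Section Bregman.
Context {R : realType} {E : normedModType R}.

Definition strongly_convex (Q : set E) (nrm : E -> R) (mu : R)
    (d : E -> R^o) : Prop :=
  forall (x y : E) (t : R), Q x -> Q y -> 0 <= t -> t <= 1 ->
    d (t *: x + (1 - t) *: y) <=
    t * d x + (1 - t) * d y - mu / 2 * t * (1 - t) * nrm (x - y) ^+ 2.

(* [V(y,x)]; the pairing of the gradient of [d] at [x] with [y - x] is the
   Frechet differential ['d d x] applied to [y - x]. *)
Definition bregman (d : E -> R^o) (y x : E) : R :=
  d y - d x - 'd d x (y - x).

Definition is_argmin (Q : set E) (phi : E -> R) (x : E) : Prop :=
  Q x /\ forall y, Q y -> phi x <= phi y.

(* Subgradients are elements of the dual space, relative to [Q]: the functions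
   to be minimized are only meaningful on [Q]. *)
Definition is_subgradient (Q : set E) (phi : E -> R) (x : E)
    (g : {linear E -> R^o}) : Prop :=
  forall z, Q z -> phi x + g (z - x) <= phi z.

Definition is_inexact_argmin (tdelta : R) (Q : set E) (phi : E -> R)
    (x : E) : Prop :=
  Q x /\ exists g : {linear E -> R^o},
    is_subgradient Q phi x g /\ forall y, Q y -> g (x - y) <= tdelta.

End Bregman.

(* Functions on [Q], [Q1], [Q2] are represented by total functions about which
   nothing is assumed outside of these sets. *)
Record is_saddle_model (R : realType) (U W : normedModType R)
    (Q : set (U * W)) (nrm : U * W -> R) (V : U * W -> U * W -> R)
    (f : U -> W -> R) (delta Delta L : R)
    (psid : U * W -> U * W -> R) : Prop := {
  model_vi : exists psi : U * W -> U * W -> R, forall x y, Q x -> Q y ->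
    psi x y <= psid x y + delta;
  model_convex : forall y, Q y ->
    convex_function Q (fun x => psid x y);
  model_diag : forall x, Q x -> psid x x = 0;
  model_monotone : forall x y, Q x -> Q y -> psid x y + psid y x <= delta;
  model_smooth : forall x y z, Q x -> Q y -> Q z ->
    psid x y <= psid x z + psid z y + L * V x z + L * V z y
                + Delta * nrm (y - z) + delta;
  model_saddle : forall x y, Q x -> Q y ->
    f y.1 x.2 - f x.1 y.2 <= - psid x y + delta
}.

Section Method.
Context {R : realType} {E : normedModType R}.
Variables (Q : set E) (nrm : E -> R) (V : E -> E -> R) (psid : E -> E -> R).
Variables (delta tdelta : R).

Definition trial_step (l : R) (xN y x : E) : Prop :=
  is_inexact_argmin tdelta Q (fun z => psid z xN + l * V z xN) y /\
  is_inexact_argmin tdelta Q (fun z => psid z y + l * V z xN) x.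

Definition step_test (l D : R) (xN y x : E) : Prop :=
  psid x xN <= psid y xN + psid x y + l * V y xN + l * V x y
               + D * nrm (y - x) + delta.

(* [line_search xN l D l' D' y x]: starting from the current constants [l], [D],
   repeating the trial step and doubling both constants after every failure of
   the test ends with the constants [l'], [D'] and the points [y], [x].
   Inexact minimizers are not unique, hence a relation. *)
Inductive line_search (xN : E) : R -> R -> R -> R -> E -> E -> Prop :=
| line_search_accept l D y x :
    trial_step l xN y x -> step_test l D xN y x ->
    line_search xN l D l D y x
| line_search_reject l D y x l' D' y' x' :
    trial_step l xN y x -> ~ step_test l D xN y x ->
    line_search xN (2 * l) (2 * D) l' D' y' x' ->
    line_search xN l D l' D' y' x'.

(* The first [N] iterations; [ys 0] is not used. *)
Definition adaptive_iterations (N : nat) (Ls Ds : nat -> R)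
    (xs ys : nat -> E) : Prop :=
  forall k, (k < N)%N ->
    line_search (xs k) (Ls k / 2) (Ds k / 2)
                (Ls k.+1) (Ds k.+1) (ys k.+1) (xs k.+1).

Definition weight_sum (Ls : nat -> R) (N : nat) : R :=
  \sum_(k < N) (Ls k.+1)^-1.

Definition stop_criterion (eps : R) (x0 : E) (Ls : nat -> R) (N : nat) : Prop :=
  sup [set V x x0 | x in Q] / eps <= weight_sum Ls N.

(* [N] is the first positive number of iterations at which the criterion holds;
   with [N = 0] the averaged point would not be defined. *)
Definition stops_after (eps : R) (x0 : E) (Ls : nat -> R) (N : nat) : Prop :=
  [/\ (0 < N)%N, stop_criterion eps x0 Ls N &
      forall m, (0 < m < N)%N -> ~ stop_criterion eps x0 Ls m].

Definition averaged_point (Ls : nat -> R) (ys : nat -> E) (N : nat) : E :=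
  (weight_sum Ls N)^-1 *: \sum_(k < N) (Ls k.+1)^-1 *: ys k.+1.

End Method.

(* [max_v f(ut,v) - min_u f(u,vt)] in the extended reals: [f] is not assumed to
   be continuous, so the extrema need not be attained. *)
Definition duality_gap (R : realType) (U W : Type) (Q1 : set U) (Q2 : set W)
    (f : U -> W -> R) (ut : U) (vt : W) : \bar R :=
  (ereal_sup [set (f ut v)%:E | v in Q2]
   - ereal_inf [set (f u vt)%:E | u in Q1])%E.

(* Main.v *)
Require Import Defs.
From mathcomp Require Import all_boot all_order all_algebra.
From mathcomp Require Import all_classical all_reals all_analysis.
From mathcomp Require Import ring lra.
Import Order.TTheory GRing.Theory Num.Theory.
Import numFieldNormedType.Exports.

(** The proof is the mirror-prox regret argument with inexact minimizers.

    Each iteration contains two approximate Bregman proximal steps from the same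
    centre [x^k].  By the first-order condition at an approximate minimizer
    ([inexact_argmin_bregman]), each step has value at most that of any
    competitor, up to [tdelta], with a gain of [L V(z, y)], where [z] is the
    competitor and [y] the minimizer.  For the first step the competitor is
    [x^{k+1}], for the second an arbitrary [z] of [Q].  In the sum of the two
    inequalities and of the acceptance test, every divergence except [V(z, x^k)]
    and [V(z, x^{k+1})] cancels ([accepted_step_bound]); the model enters only
    through [psid z y^{k+1}].

    Dividing by [L_{k+1}] makes the remaining divergences telescope, and the last
    one can be dropped because [V >= 0] ([weighted_model_bound]).  The stopping
    rule gives [V(z, x^0) <= eps S_N].  The link
    [f(u_y, v) - f(u, v_y) <= - psid (u, v) y + delta] and Jensen's inequality
    in each variable ([jensen_average]) turn the bound on the weighted sum of the
    model into a bound on [f(ut, v) - f(u, vt)] that is uniform in [u] and [v],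
    which is the duality gap ([duality_gap_le]). *)

Set Implicit Arguments.
Unset Strict Implicit.
Unset Printing Implicit Defensive.

Local Open Scope classical_set_scope.
Local Open Scope ring_scope.

(** * Convexity *)

Lemma convex_set_segment {R : realType} {E : lmodType R} (D : set E) (x y : E)
    (t : R) :
  convex_set D -> D x -> D y -> 0 <= t -> t <= 1 -> D (t *: x + (1 - t) *: y).
Proof.
move=> cD Dx Dy t0 t1.
by have := cD x y (Itv01 t0 t1) (mem_set Dx) (mem_set Dy); rewrite inE.
Qed.

Lemma convex_function_segment {R : realType} {E : lmodType R} (D : set E)
    (f : E -> R) (x y : E) (t : R) :
  convex_function D f -> D x -> D y -> 0 <= t -> t <= 1 ->
  f (t *: x + (1 - t) *: y) <= t * f x + (1 - t) * f y.
Proof.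
move=> cf Dx Dy t0 t1.
exact: cf (Itv01 t0 t1) x y (mem_set Dx) (mem_set Dy).
Qed.

(** Jensen's inequality, by induction on the number of points: the new average is
    a convex combination of the old average and of the last point.  Multiplying
    by the total weight keeps divisions out of the inequality. *)
Lemma jensen_average {R : realType} {E : lmodType R} (D : set E) (w : nat -> R)
    (x : nat -> E) (N : nat) :
  convex_set D -> (0 < N)%N -> (forall k, (k < N)%N -> 0 < w k) ->
  (forall k, (k < N)%N -> D (x k)) ->
  let S := \sum_(k < N) w k in
  let a := S^-1 *: \sum_(k < N) w k *: x k in
  D a /\ forall f : E -> R, convex_function D f ->
         S * f a <= \sum_(k < N) w k * f (x k).
Proof.
move=> cD; elim: N => // n IHn _ w_gt0 Dx /=.
case: n => [|n] in IHn w_gt0 Dx *.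
  have w0 : 0 < w 0%N by exact: w_gt0.
  rewrite !big_ord1 scalerA mulVf ?gt_eqF// scale1r; split; first exact: Dx.
  by move=> f _; rewrite big_ord1.
have [//|k kn|k kn|Da fa] := IHn; [exact/w_gt0/ltnW|exact/Dx/ltnW|].
rewrite [\sum_(k < n.+2) w k]big_ord_recr [\sum_(k < n.+2) w k *: _]big_ord_recr.
rewrite /=; set S := \sum_(k < n.+1) w k in Da fa *; set a := S^-1 *: _ in Da fa.
have S_gt0 : 0 < S.
  rewrite /S big_ord_recl; apply: ltr_wpDr; last exact: w_gt0.
  by apply: sumr_ge0 => k _; apply/ltW/w_gt0; rewrite (leq_trans (ltn_ord _)).
have wn_gt0 : 0 < w n.+1 by exact: w_gt0.
have T_gt0 : 0 < S + w n.+1 by exact: addr_gt0.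
have T_neq0 : S + w n.+1 != 0 by rewrite gt_eqF.
set T := S + w n.+1 in T_gt0 T_neq0 *.
pose t := S / T.
have t_ge0 : 0 <= t by rewrite divr_ge0// ltW.
have t_le1 : t <= 1 by rewrite ler_pdivrMr// mul1r lerDl ltW.
have onemt : 1 - t = w n.+1 / T.
  by rewrite -[1](divff T_neq0) -mulrBl /T addrC addKr.
have -> : T^-1 *: (\sum_(i < n.+1) w i *: x i + w n.+1 *: x n.+1) =
          t *: a + (1 - t) *: x n.+1.
  rewrite scalerDr onemt /t /a !scalerA ![T^-1 * _]mulrC; congr (_ *: _ + _).
  by rewrite mulrAC divff ?mul1r ?gt_eqF.
have Dxn : D (x n.+1) by exact: Dx.
split=> [|f cf]; first exact: convex_set_segment.
rewrite [leRHS]big_ord_recr/=; apply: le_trans (lerD (fa f cf) (lexx _)).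
have -> : S * f a + w n.+1 * f (x n.+1) =
          T * (t * f a + (1 - t) * f (x n.+1)).
  by rewrite onemt /t; field.
by rewrite ler_pM2l//; exact: convex_function_segment cf _ _ _ _.
Qed.

(** * Bregman divergences and approximate proximal steps *)

Section Bregman.
Context {R : realType} {E : normedModType R}.
Implicit Types (Q : set E) (d : E -> R^o) (x y z : E).

(** Only the right limit at 0 is considered: the points of the segment from [y] to
    [z] are the ones that stay in a convex set. *)
Lemma cvg_right_diff_quotient d y z : differentiable d y ->
  t^-1 * (d (t *: z + (1 - t) *: y) - d y) @[t --> 0^'+] --> 'd d y (z - y).
Proof.
move=> dy; rewrite -deriveE//.
have : derivable d y (z - y) by exact: diff_derivable.
rewrite /derivable => /cvg_dnbhs_at_right dvx.
have quotE : (fun t : R => t^-1 * (d (t *: z + (1 - t) *: y) - d y)) =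
             (fun t => t^-1 *: ((d \o shift y) (t *: (z - y)) - d y)).
  apply/funext => t /=; congr (_ * (d _ - _)).
  by rewrite scalerBr scalerBl scale1r addrA addrAC.
by rewrite quotE.
Qed.

Arguments cvg_right_diff_quotient d [y] z _.

Lemma bregman_three_points d x y z :
  bregman d z x - bregman d z y - bregman d y x =
  'd d y (z - y) - 'd d x (z - y).
Proof.
rewrite /bregman !linearB /=; lra.
Qed.

(** The slopes of a convex function along a segment are bounded by the slope of
    its chord, hence so is their limit, the directional derivative. *)
Lemma bregman_ge0 Q (nrm : E -> R) d x z :
  strongly_convex Q nrm 1 d -> differentiable d x -> Q x -> Q z ->
  0 <= bregman d z x.
Proof.
move=> scd dx Qx Qz; rewrite subr_ge0.
apply: (cvgr_to_le (cvg_right_diff_quotient d z dx)).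
near=> t.
have t_gt0 : 0 < t by [].
have t_le1 : t <= 1 by near: t; apply: nbhs_right_le.
rewrite mulrC ler_pdivrMr//.
have := scd z x t Qz Qx (ltW t_gt0) t_le1.
have : 0 <= 1 / 2 * t * (1 - t) * nrm (z - x) ^+ 2.
  by rewrite mulr_ge0 ?sqr_ge0 ?mulr_ge0 ?subr_ge0 ?divr_ge0 ?(ltW t_gt0).
lra.
Unshelve. all: by end_near. Qed.

(** A subgradient of the sum need not be given as the sum of a subgradient of [p]
    and of the derivative of the divergence.  It is tested on the segment from
    [y] to [z], where convexity bounds the increment of [p] by a linear one;
    after division by [t], as [t] tends to 0, the increment of [d] becomes its
    derivative at [y], and the three-point identity expresses the difference of
    the derivatives of [d] at [y] and at [x] by divergences. *)
Lemma inexact_argmin_bregman Q d (p : E -> R) (tdelta l : R) x y z :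
  convex_set Q -> convex_function Q p -> differentiable d y ->
  is_inexact_argmin tdelta Q (fun u => p u + l * bregman d u x) y -> Q z ->
  p y <= p z + l * bregman d z x - l * bregman d z y - l * bregman d y x
         + tdelta.
Proof.
move=> cQ cp dy [Qy [g [sg gy]]] Qz.
(* The first-order condition in the direction [z - y]: the convex part has been
   replaced by its chord and the smooth part by its derivative. *)
suff : g (z - y) - (p z - p y) + l * 'd d x (z - y) <= l * 'd d y (z - y).
  have := gy z Qz; rewrite -[y - z]opprB linearN /=.
  have : l * (bregman d z x - bregman d z y - bregman d y x) =
     l * ('d d y (z - y) - 'd d x (z - y)) by rewrite bregman_three_points.
  lra.
have lim_d : l * (t^-1 * (d (t *: z + (1 - t) *: y) - d y)) @[t --> 0^'+] -->
             l * 'd d y (z - y).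
  by apply: cvgMl_tmp; exact: cvg_right_diff_quotient.
apply: (cvgr_to_ge lim_d).
near=> t.
have t_gt0 : 0 < t by [].
have t_le1 : t <= 1 by near: t; apply: nbhs_right_le.
set q := t *: z + (1 - t) *: y.
have qy : q - y = t *: (z - y).
  by rewrite /q scalerBr scalerBl scale1r -addrA addrAC subrr add0r.
have Qq : Q q by apply: convex_set_segment; rewrite // ltW.
have := sg q Qq.
have := convex_function_segment cp Qz Qy (ltW t_gt0) t_le1; rewrite -/q.
have -> : bregman d q x = bregman d y x + (d q - d y - t * 'd d x (z - y)).
  have -> : t * 'd d x (z - y) = 'd d x (q - y) by rewrite qy linearZ.
  by rewrite /bregman !linearB /=; lra.
rewrite qy linearZ /= => pq gq.
rewrite mulrCA ler_pdivlMl//.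
rewrite /GRing.scale /= in gq; lra.
Unshelve. all: by end_near. Qed.

End Bregman.

(** Without this bound the supremum in the stopping criterion would not dominate
    the values of the divergence. *)
Lemma bregman_bounded {R : realType} {E : normedModType R} (Q : set E)
    (d : E -> R^o) (x : E) :
  compact Q -> (forall y, Q y -> differentiable d y) -> Q x ->
  has_ubound [set bregman d z x | z in Q].
Proof.
move=> cptQ diffd Qx.
have cV : {within Q, continuous (fun z => bregman d z x)}.
  apply: continuous_in_subspaceT => z /set_mem Qz.
  have dz : {for z, continuous d}.
    by apply: differentiable_continuous; exact: diffd.
  have shiftz : {for z, continuous (fun z => z - x)}.
    by apply: cvgB; [exact: cvg_id|exact: cvg_cst].
  have diffz : {for z, continuous (fun z => 'd d x (z - x))}.
    apply: (continuous_comp shiftz).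
    by apply: diff_continuous; exact: diffd.
  have dxz : {for z, continuous (fun z => d z - d x)}.
    by apply: cvgB; [exact: dz|exact: cvg_cst].
  exact: cvgB dxz diffz.
have [c _ max_c] := compact_EVT_max (ex_intro _ x Qx) cptQ cV.
by exists (bregman d c x) => _ [z Qz <-]; apply: max_c; rewrite inE.
Qed.

(** * Regret of the adaptive method *)

Section Method.
Context {R : realType} {E : normedModType R}.
Variables (Q : set E) (nrm : E -> R) (d : E -> R^o) (psid : E -> E -> R).
Variables (delta tdelta : R).
Hypotheses (cvxQ : convex_set Q)
  (scd : strongly_convex Q nrm 1 d) (diffd : forall x, Q x -> differentiable d x)
  (cvx_psid : forall y, Q y -> convex_function Q (fun x => psid x y)).

Local Notation V := (bregman d).

Lemma line_search_result (xN y x : E) (l D l' D' : R) :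
  line_search Q nrm V psid delta tdelta xN l D l' D' y x -> 0 < l ->
  [/\ 0 < l', trial_step Q V psid tdelta l' xN y x &
      step_test nrm V psid delta l' D' xN y x].
Proof.
elim=> {l D l' D' y x} [l D y x ? ? l0 //|l D y x l' D' y' x' _ _ _ IH l0].
by apply: IH; rewrite mulr_gt0.
Qed.

(** Optimality of [y] is tested against [x], and optimality of [x] against [z].
    With the acceptance test, [V y xN], [V x y], [V x xN] and the model values at
    the iterates cancel, which leaves [psid z y]. *)
Lemma accepted_step_bound (xN y x z : E) (l D : R) :
  Q xN -> trial_step Q V psid tdelta l xN y x ->
  step_test nrm V psid delta l D xN y x -> Q z ->
  - psid z y <= l * V z xN - l * V z x + D * nrm (y - x) + delta + 2 * tdelta.
Proof.
move=> QxN [ymin xmin]; have Qy := ymin.1; have Qx := xmin.1.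
rewrite /step_test => test Qz.
have := inexact_argmin_bregman cvxQ (cvx_psid QxN) (diffd Qy) ymin Qx.
have := inexact_argmin_bregman cvxQ (cvx_psid Qy) (diffd Qx) xmin Qz.
lra.
Qed.

Variables (Ls Ds : nat -> R) (xs ys : nat -> E) (N : nat).
Hypotheses (Ls0_gt0 : 0 < Ls 0%N) (Qx0 : Q (xs 0%N))
  (iters : adaptive_iterations Q nrm V psid delta tdelta N Ls Ds xs ys).

Lemma iterates_invariant k : (k <= N)%N -> 0 < Ls k /\ Q (xs k).
Proof.
elim: k => // k IH kN; have [Lk Qk] := IH (ltnW kN).
have [//|lk [_ [Qx _]] _] := line_search_result (iters kN); last by [].
by rewrite divr_gt0.
Qed.

Lemma iterate_step k : (k < N)%N ->
  [/\ 0 < Ls k.+1, Q (ys k.+1) & forall z, Q z ->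
    - psid z (ys k.+1) <= Ls k.+1 * V z (xs k) - Ls k.+1 * V z (xs k.+1)
      + Ds k.+1 * nrm (ys k.+1 - xs k.+1) + delta + 2 * tdelta].
Proof.
move=> kN; have [Lk Qk] := iterates_invariant (ltnW kN).
have [|lk trial test] := line_search_result (iters kN); first by rewrite divr_gt0.
split=> // [|z Qz]; first by case: trial => -[].
exact: accepted_step_bound Qk trial test Qz.
Qed.

(** After division by [Ls k.+1] the divergences have coefficient 1, so they
    telescope even though the constants vary from one iteration to the next. *)
Lemma weighted_model_bound z : Q z ->
  \sum_(k < N) (Ls k.+1)^-1 * - psid z (ys k.+1) <=
  V z (xs 0%N) + \sum_(k < N) Ds k.+1 * nrm (ys k.+1 - xs k.+1) / Ls k.+1
  + weight_sum Ls N * (delta + 2 * tdelta).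
Proof.
move=> Qz; rewrite /weight_sum.
have VN_ge0 : 0 <= V z (xs N).
  have [_ QxN] := iterates_invariant (leqnn N).
  exact: bregman_ge0 scd (diffd QxN) QxN Qz.
(* The induction keeps the last divergence on the left-hand side. *)
suff H m : (m <= N)%N ->
    \sum_(k < m) (Ls k.+1)^-1 * - psid z (ys k.+1) + V z (xs m) <=
    V z (xs 0%N) + \sum_(k < m) Ds k.+1 * nrm (ys k.+1 - xs k.+1) / Ls k.+1
    + (\sum_(k < m) (Ls k.+1)^-1) * (delta + 2 * tdelta).
  by have := H N (leqnn N); lra.
elim: m => [_|m IH mN]; first by rewrite !big_ord0; lra.
have {IH} := IH (ltnW mN); rewrite !big_ord_recr /=.
have [L_gt0 _ /(_ z Qz)] := iterate_step mN.
rewrite -(ler_pM2l (_ : 0 < (Ls m.+1)^-1)) ?invr_gt0// => step.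
have cancel a : (Ls m.+1)^-1 * (Ls m.+1 * a) = a by rewrite mulKf// gt_eqF.
(* The divergences are generalized so that distributing the products does not
   unfold them. *)
move: (V z (xs m)) (V z (xs m.+1)) step => vm vm1; rewrite !mulrDr !mulrN !cancel; lra.
Qed.

End Method.

(** * The duality gap *)

(** Nonemptiness of both sets and the bound make the supremum and the infimum
    finite, so that no indeterminate difference of infinities occurs. *)
Lemma duality_gap_le {R : realType} {U W : Type} (Q1 : set U) (Q2 : set W)
    (f : U -> W -> R) (ut : U) (vt : W) (B : R) :
  Q1 !=set0 -> Q2 !=set0 ->
  (forall u v, Q1 u -> Q2 v -> f ut v - f u vt <= B) ->
  (duality_gap Q1 Q2 f ut vt <= B%:E)%E.
Proof.
move=> [u0 Qu0] [v0 Qv0] gapB; rewrite /duality_gap.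
set M := ereal_sup _; set m := ereal_inf _.
have M_le u : Q1 u -> (M <= (f u vt + B)%:E)%E.
  move=> Qu; apply: ge_ereal_sup => _ [v Qv <-].
  by rewrite lee_fin -lerBlDl gapB.
have M_fin : M \is a fin_num.
  rewrite fin_real// (lt_le_trans (ltNyr (f ut v0))); last first.
    by apply: ereal_sup_ubound; exists v0.
  by rewrite (le_lt_trans (M_le _ Qu0)) ?ltry.
have M_le_m : (M - B%:E <= m)%E.
  by apply: le_ereal_inf_tmp => _ [u Qu <-]; rewrite leeBlDr// -EFinD M_le.
have m_fin : m \is a fin_num.
  rewrite fin_real// (lt_le_trans _ M_le_m)/=; last first.
    by rewrite -(fineK M_fin) -EFinB ltNyr.
  by apply: le_lt_trans (ltry (f u0 vt)); apply: ereal_inf_lbound; exists u0.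
by rewrite leeBlDr// -leeBlDl//.
Qed.

Theorem mainTheorem4 (R : realType) (n1 n2 : nat)
    (N1 : 'rV[R]_n1 -> R) (N2 : 'rV[R]_n2 -> R)
    (Q1 : set 'rV[R]_n1) (Q2 : set 'rV[R]_n2)
    (f : 'rV[R]_n1 -> 'rV[R]_n2 -> R)
    (d : 'rV[R]_n1 * 'rV[R]_n2 -> R^o)
    (psid : 'rV[R]_n1 * 'rV[R]_n2 -> 'rV[R]_n1 * 'rV[R]_n2 -> R)
    (delta Delta L tdelta eps : R) (N : nat)
    (Ls Ds : nat -> R) (xs ys : nat -> 'rV[R]_n1 * 'rV[R]_n2) :
  let Q := Q1 `*` Q2 in
  let nrm := pair_norm N1 N2 in
  let V := bregman d in
  is_norm N1 -> is_norm N2 ->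
  convex_set Q1 -> compact Q1 -> convex_set Q2 -> compact Q2 ->
  (forall v, Q2 v -> convex_function Q1 (fun u => f u v)) ->
  (forall u, Q1 u -> convex_function Q2 (fun v => - f u v)) ->
  strongly_convex Q nrm 1 d ->
  (forall x, Q x -> differentiable d x) ->
  0 < delta -> 0 < Delta -> 0 < L -> 0 <= tdelta -> 0 < eps ->
  is_saddle_model Q nrm V f delta Delta L psid ->
  is_argmin Q d (xs 0%N) ->
  0 < Ls 0%N <= 2 * L -> 0 < Ds 0%N <= 2 * Delta ->
  adaptive_iterations Q nrm V psid delta tdelta N Ls Ds xs ys ->
  stops_after Q V eps (xs 0%N) Ls N ->
  let S := weight_sum Ls N in
  let yt := averaged_point Ls ys N in
  (duality_gap Q1 Q2 f yt.1 yt.2 <=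
   (eps
    + S^-1 * (\sum_(k < N) Ds k.+1 * nrm (ys k.+1 - xs k.+1) / Ls k.+1)
    + 2 * tdelta + 2 * delta)%:E)%E.
Proof.
move=> Q nrm V _ _ cQ1 cptQ1 cQ2 cptQ2 cvxf cvxNf scd diffd _ _ _ _ eps_gt0.
move=> model [Qx0 _] /andP[Ls0 _] _ iters [N_gt0 stop _].
cbv zeta; set S := weight_sum Ls N; set yt := averaged_point Ls ys N.
have cQ : convex_set Q.
  move=> x y t /set_mem[x1 x2] /set_mem[y1 y2]; apply/mem_set; split.
    by apply/set_mem/cQ1; exact/mem_set.
  by apply/set_mem/cQ2; exact/mem_set.
have cptQ : compact Q by exact: compact_setX.
have steps := iterate_step cQ diffd (model_convex model) Ls0 Qx0 iters.
have L_gt0 k : (k < N)%N -> 0 < (Ls k.+1)^-1.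
  by move=> /steps[Lk _ _]; rewrite invr_gt0.
have Qy k : (k < N)%N -> Q (ys k.+1) by move=> /steps[].
have S_gt0 : 0 < S.
  rewrite /S /weight_sum (bigD1 (Ordinal N_gt0))//=.
  by apply: ltr_wpDr; [apply: sumr_ge0 => k _; exact/ltW/L_gt0|exact: L_gt0].
have yt1 : yt.1 = S^-1 *: \sum_(k < N) (Ls k.+1)^-1 *: (ys k.+1).1.
  rewrite /yt /averaged_point /=; congr (_ *: _).
  exact: (big_morph fst (fun _ _ => erefl) erefl).
have yt2 : yt.2 = S^-1 *: \sum_(k < N) (Ls k.+1)^-1 *: (ys k.+1).2.
  rewrite /yt /averaged_point /=; congr (_ *: _).
  exact: (big_morph snd (fun _ _ => erefl) erefl).
have [_ jensen1] := jensen_average cQ1 N_gt0 L_gt0 (fun k kN => (Qy k kN).1).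
have [_ jensen2] := jensen_average cQ2 N_gt0 L_gt0 (fun k kN => (Qy k kN).2).
rewrite -yt1 -/S in jensen1; rewrite -yt2 -/S in jensen2.
apply: duality_gap_le; [by exists (xs 0%N).1; case: Qx0
                       |by exists (xs 0%N).2; case: Qx0|].
move=> u v Qu Qv; have Qz : Q (u, v) by [].
set T := \sum_(k < N) _.
rewrite -(ler_pM2l S_gt0).
have -> : S * (eps + S^-1 * T + 2 * tdelta + 2 * delta) =
          S * eps + T + S * (delta + 2 * tdelta) + S * delta.
  by field; rewrite gt_eqF.
(* The stopping criterion, multiplied by [eps]. *)
have V_le : bregman d (u, v) (xs 0%N) <= S * eps.
  rewrite -ler_pdivrMr//; apply: le_trans stop.
  rewrite ler_pM2r ?invr_gt0//.
  by apply: ub_le_sup; [exact: bregman_bounded|exists (u, v)].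
have regret := weighted_model_bound cQ scd diffd (model_convex model) Ls0 Qx0
  iters Qz.
rewrite -/S -/T in regret.
(* Jensen in each variable, then the link between the model and [f]. *)
have gap_le : S * f yt.1 v + S * (- f u yt.2) <=
    \sum_(k < N) (Ls k.+1)^-1 * (- psid (u, v) (ys k.+1)) + S * delta.
  apply: le_trans (lerD (jensen1 _ (cvxf v Qv)) (jensen2 _ (cvxNf u Qu))) _.
  rewrite /S /weight_sum mulr_suml -!big_split /=; apply: ler_sum => k _.
  rewrite -!mulrDr ler_pM2l ?L_gt0//.
  exact: (model_saddle model Qz (Qy k (ltn_ord k))).
have := le_trans gap_le (lerD regret (lexx _)); lra.
Qed.
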